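(* Let $(\mathfrak{g},\phi_\mathfrak{g})$ be a LeibDer pair. The bracket $\llbracket\,,\,\rrbracket^{\sim}: C^m_{\mathrm{LeibDer}}(\mathfrak{g},\mathfrak{g})\times C^n_{\mathrm{LeibDer}}(\mathfrak{g},\mathfrak{g})\to C^{m+n-1}_{\mathrm{LeibDer}}(\mathfrak{g},\mathfrak{g})$ given by $$\llbracket (f,\overline f),(g,\overline g)\rrbracket^{\sim} := \big(\llbracket f,g\rrbracket,\ (-1)^{m+1}\llbracket f,\overline g\rrbracket+\llbracket \overline f,g\rrbracket\big)$$ defines a degree $-1$ graded Lie bracket on the graded space $C^\ast_{\mathrm{LeibDer}}(\mathfrak{g},\mathfrak{g})$.
   Context: All vector spaces and linear maps are over a field $\mathbb{K}$ of characteristic zero. A (right) Leibniz algebra is a vector space $\mathfrak{g}$ with a bilinear bracket satisfying $[[x,y],z]=[[x,z],y]+[x,[y,z]]$. A LeibDer pair $(\mathfrak{g},\phi_\mathfrak{g})$ is a Leibniz algebra $\mathfrak{g}$ with a derivation $\phi_\mathfrak{g}$, i.e. a linear map $\phi_\mathfrak{g}:\mathfrak{g}\to\mathfrak{g}$ with $\phi_\mathfrak{g}[x,y]=[\phi_\mathfrak{g}(x),y]+[x,\phi_\mathfrak{g}(y)]$. Write $C^n(\mathfrak{g},\mathfrak{g})=\mathrm{Hom}(\mathfrak{g}^{\otimes n},\mathfrak{g})$. For $f\in C^m(\mathfrak{g},\mathfrak{g})$, $g\in C^n(\mathfrak{g},\mathfrak{g})$ (with $m,n\ge 1$), set $\llbracket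 f,g\rrbracket=f\bullet g-(-1)^{(m-1)(n-1)}g\bullet f\in C^{m+n-1}(\mathfrak{g},\mathfrak{g})$, where $$(f\bullet g)(x_1,\ldots,x_{m+n-1})=\sum_{i=1}^m(-1)^{(i-1)(n-1)}\sum_{\sigma\in \mathrm{Sh}(n-1,m-i)}\mathrm{sgn}(\sigma)\, f\big(x_1,\ldots,x_{i-1},g(x_i,x_{\sigma(i+1)},\ldots,x_{\sigma(i+n-1)}),x_{\sigma(i+n)},\ldots,x_{\sigma(m+n-1)}\big),$$ and $\mathrm{Sh}(n-1,m-i)$ denotes the set of $(n-1,m-i)$-shuffles of $\{i+1,\ldots,m+n-1\}$. This is a degree $-1$ graded Lie bracket on $C^\ast(\mathfrak{g},\mathfrak{g})$. The cochain groups of the LeibDer pair with coefficients in itself are $C^0_{\mathrm{LeibDer}}(\mathfrak{g},\mathfrak{g})=0$, $C^1_{\mathrm{LeibDer}}(\mathfrak{g},\mathfrak{g})=\mathrm{Hom}(\mathfrak{g},\mathfrak{g})$ (whose elements $f$ are regarded as pairs $(f,0)$), and $C^n_{\mathrm{LeibDer}}(\mathfrak{g},\mathfrak{g})=\mathrm{Hom}(\mathfrak{g}^{\otimes n},\mathfrak{g})\times\mathrm{Hom}(\mathfrak{g}^{\otimes n-1},\mathfrak{g})$ for $n\ge2$. A degree $-1$ graded Lie bracket on a graded space $C^\ast$ is a bilinear bracket $C^m\times C^n\to C^{m+n-1}$ which makes the shifted space $C^{\ast+1}$ (elements of $C^n$ having degree $n-1$) into a graded Lie algebra, i.e. it is graded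 skew-symmetric and satisfies the graded Jacobi identity with respect to the shifted degrees. *)

(* Defs.v *)
From HB Require Import structures.
From mathcomp Require Import all_boot all_order all_fingroup all_algebra.
(* boolp and functions provide the lmodType structure of function spaces. *)
From mathcomp Require Import boolp classical_sets functions.
Set Implicit Arguments.
Unset Strict Implicit.
Unset Printing Implicit Defensive.
Import Order.TTheory GRing.Theory Num.Theory.
Local Open Scope ring_scope.

Record leibniz_algebra (K : fieldType) := LeibnizAlgebra {
  leib_space :> lmodType K ;
  leib_bracket : {bilinear leib_space -> leib_space -> leib_space} ;
  leib_identity : forall x y z,
    leib_bracket (leib_bracket x y) z =
    leib_bracket (leib_bracket x z) y + leib_bracket x (leib_bracket y z) }.

Record leibder_pair (K : fieldType) := LeibDerPair {
  leibder_algebra :> leibniz_algebra K ;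
  leibder_derivation : {linear leibder_algebra -> leibder_algebra} ;
  leibder_derivationP : forall x y : leibder_algebra,
    leibder_derivation (leib_bracket _ x y) =
    leib_bracket _ (leibder_derivation x) y +
    leib_bracket _ x (leibder_derivation y) }.

Section Cochains.
Variables (K : fieldType) (V : lmodType K).

Definition multilinear_map n (f : ('I_n -> V) -> V) : Prop :=
  forall (x : 'I_n -> V) (k : 'I_n) (a : K) (u v : V),
    f [eta x with k |-> a *: u + v] =
    a *: f [eta x with k |-> u] + f [eta x with k |-> v].

Definition multilinear_pred n : {pred ('I_n -> V) -> V} :=
  fun f => `[< multilinear_map f >].

Lemma multilinear_submod_closed n : submod_closed (@multilinear_pred n).
Proof.
split=> [|c f h /asboolP fP /asboolP hP].
  by apply/asboolP => x k a u v; rewrite /= scaler0 addr0.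
apply/asboolP => x k a u v.
have E y : (c *: f + h) y = c *: f y + h y by [].
by rewrite !E fP hP !scalerDr !scalerA [c * a]mulrC addrACA.
Qed.

HB.instance Definition _ n :=
  GRing.isSubmodClosed.Build K (('I_n -> V) -> V) (@multilinear_pred n)
    (@multilinear_submod_closed n).

(* Hom(V^{(x)n}, V), as the space of n-linear maps V^n -> V. *)
Record cochain n := Cochain {
  cochain_fun :> ('I_n -> V) -> V ;
  cochain_funP : cochain_fun \in @multilinear_pred n }.

HB.instance Definition _ n := [isSub for @cochain_fun n].
HB.instance Definition _ n := [Choice of cochain n by <:].
HB.instance Definition _ n := [SubChoice_isSubLmodule of cochain n by <:].

(* Arities are shifted by one and positions are counted from 0: for f of arity
   m + 1, g of arity n + 1 and p = m + n, f (insertion g i y) is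
   f (y_0, .., y_(i-1), g (y_i, .., y_(i+n)), y_(i+n+1), .., y_p).
   All the arguments of inord are then at most p. *)
Definition insertion m n p (g : cochain n.+1) (i : 'I_m.+1)
    (y : 'I_p.+1 -> V) : 'I_m.+1 -> V :=
  fun j => if (j < i)%N then y (inord j)
           else if j == i then g (fun k : 'I_n.+1 => y (inord (i + k)))
           else y (inord (j + n)).

(* The permutations s of 0 .. p that are (n, p - i - n)-shuffles of
   i + 1 .. p, extended by the identity on 0 .. i. *)
Definition is_shuffle p (i n : nat) (s : 'S_p.+1) : bool :=
  [&& [forall j : 'I_p.+1, (j <= i)%N ==> (s j == j)],
      [forall j : 'I_p.+1, forall k : 'I_p.+1,
        [&& i < j, j < k & k <= i + n]%N ==> (s j < s k)%N] &
      [forall j : 'I_p.+1, forall k : 'I_p.+1,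
        [&& i + n < j & j < k]%N ==> (s j < s k)%N]].

Definition bullet_fun m n p (f : cochain m.+1) (g : cochain n.+1)
    (x : 'I_p.+1 -> V) : V :=
  \sum_(i < m.+1) (-1) ^+ (i * n) *:
    \sum_(s : 'S_p.+1 | is_shuffle i n s)
      (-1) ^+ s *: f (insertion g i (x \o s)).

Lemma insertion_linear m n p (e : (m + n)%N = p) (f : cochain m.+1)
    (g : cochain n.+1) (i : 'I_m.+1) :
  multilinear_map (fun y : 'I_p.+1 -> V => f (insertion g i y)).
Proof.
move: (cochain_funP f) (cochain_funP g) => /asboolP fP /asboolP gP y k a u v.
have lti : (i < m.+1)%N by [].
have inE q : (q <= p)%N -> (inord q == k) = (q == k :> nat).
  by move=> qp; rewrite -val_eqE /= inordK.
have bnd j : (j < m.+1)%N -> (j <= p)%N /\ (j + n <= p)%N.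
  by rewrite -e ltnS => jm; rewrite leq_add2r jm (leq_trans jm (leq_addr _ _)).
have bnd' (l : 'I_n.+1) : (i + l <= p)%N.
  by rewrite -e leq_add // -ltnS.
have outside (j0 : 'I_m.+1) :
    j0 != i -> (k = (if j0 < i then j0 : nat else j0 + n) :> nat)%N ->
    forall w, insertion g i [eta y with k |-> w] =
              [eta insertion g i y with j0 |-> w].
  move=> j0i kE w; apply/funext => j; rewrite /insertion /=.
  have [jp jnp] := bnd j (ltn_ord j).
  case: (ltngtP j i) => [ji|ij|/val_inj ji].
  - rewrite inE //; have [jj0|jj0] := eqVneq j j0.
    + by rewrite kE -jj0 ji eqxx.
    + case: eqP => // jk; case/eqP: jj0; apply: val_inj => /=.
      move: kE; case: ifP => [_ <- //|/negbT]; rewrite -leqNgt => ij0 kE.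
      by move: ji; rewrite jk kE ltnNge (leq_trans ij0 (leq_addr _ _)).
  - rewrite -val_eqE (gtn_eqF ij) inE //; have [jj0|jj0] := eqVneq j j0.
    + by rewrite kE -jj0 ltnNge (ltnW ij) /= eqxx.
    + case: eqP => // jk; case/eqP: jj0; apply: val_inj => /=.
      move: kE; case: ifP => [ij0 kE|_ kE].
        move: ij; rewrite ltnNge => /negP[]; apply: ltnW.
        by apply: leq_ltn_trans ij0; rewrite -kE -jk leq_addr.
      by apply: (@addIn n); rewrite jk kE.
  - rewrite -!val_eqE ji eqxx /=; have -> : (i == j0 :> nat) = false.
      by apply/negbTE; rewrite eq_sym.
    congr (g _); apply/funext => l /=; rewrite inE //; case: eqP => // ik.
    move: kE ik; case: ifP => [j0lt -> il|/negbT].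
      by move: j0lt; rewrite -il ltnNge leq_addr.
    rewrite -leqNgt => ij0 -> il; have := ltn_ord l.
    have ij0' : (i < j0)%N by rewrite ltn_neqAle ij0 andbT eq_sym.
    have : (i + l < j0 + n)%N.
      by rewrite -addSn leq_add // -ltnS.
    by rewrite il ltnn.
case: (ltnP k i) => [ki|ik].
  have km : (k < m.+1)%N by exact: ltn_trans ki lti.
  have kmi : Ordinal km != i by rewrite -val_eqE /= ltn_eqF.
  by rewrite !(outside _ kmi) ?fP //= ki.
case: (leqP k (i + n)) => [kin|ink].
  have kil : (k - i < n.+1)%N by rewrite ltnS leq_subLR.
  have inside w : insertion g i [eta y with k |-> w] =
      [eta insertion g i y with i |->
        g [eta (fun l : 'I_n.+1 => y (inord (i + l)))
           with Ordinal kil |-> w]].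
    apply/funext => j; rewrite /insertion /=.
    have [jp jnp] := bnd j (ltn_ord j).
    case: (ltngtP j i) => [ji|ij|/val_inj ji].
    - by rewrite inE // -val_eqE (ltn_eqF ji) (ltn_eqF (leq_trans ji ik)).
    - rewrite inE // -val_eqE (gtn_eqF ij) gtn_eqF //.
      by apply: leq_ltn_trans kin _; rewrite ltn_add2r.
    - rewrite ji eqxx; congr (g _); apply/funext => l /=; rewrite inE //.
      by rewrite -val_eqE /= -[in LHS](subnKC ik) eqn_add2l.
  by rewrite !inside gP fP.
have nk : (n <= k)%N by apply: ltnW; apply: leq_ltn_trans ink; rewrite leq_addl.
have km : (k - n < m.+1)%N by rewrite ltnS leq_subLR addnC e -ltnS.
have ikn : (i < k - n)%N by rewrite ltn_subRL addnC.
have kmi : Ordinal km != i by rewrite -val_eqE /= gtn_eqF.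
by rewrite !(outside _ kmi) ?fP //= ltnNge (ltnW ikn) /= subnK.
Qed.

Lemma bullet_funP m n p (e : (m + n)%N = p) (f : cochain m.+1)
    (g : cochain n.+1) :
  @bullet_fun m n p f g \in @multilinear_pred p.+1.
Proof.
apply/asboolP => x k a u v; rewrite /bullet_fun scaler_sumr -big_split /=.
apply: eq_bigr => i _; rewrite scalerA mulrC -scalerA -scalerDr; congr (_ *: _).
rewrite scaler_sumr -big_split /=; apply: eq_bigr => s _.
rewrite scalerA mulrC -scalerA -scalerDr; congr (_ *: _).
have E w : [eta x with k |-> w] \o s = [eta x \o s with (s^-1)%g k |-> w].
  by apply/funext => j /=; rewrite -(inj_eq (@perm_inj _ s) j) permKV.
by rewrite !E insertion_linear.
Qed.

Definition bullet m n p (e : (m + n)%N = p) (f : cochain m.+1)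
    (g : cochain n.+1) : cochain p.+1 :=
  Cochain (bullet_funP e f g).

Lemma predn_arity m n p : (m.+1 + n.+1)%N = p.+2 -> (m + n)%N = p.
Proof. by rewrite addSn addnS => -[]. Qed.

(* The bracket C^m x C^n -> C^(m+n-1); the target arity p is passed together
   with a proof of m + n - 1 = p, which avoids transports. Only m, n >= 1 is
   meaningful; the value 0 for m = 0 or n = 0 is a convention, only ever used
   on zero cochains. *)
Definition cochain_bracket (m n p : nat) :
    (m + n)%N = p.+1 -> cochain m -> cochain n -> cochain p :=
  match m, n, p with
  | m'.+1, n'.+1, p'.+1 => fun e f g =>
      bullet (predn_arity e) f g -
      (-1) ^+ (m' * n') *: bullet (predn_arity (etrans (addnC _ _) e)) g f
  | _, _, _ => fun _ _ _ => 0
  end.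

End Cochains.

Section LeibDerCochains.
Variables (K : fieldType) (V : lmodType K).

(* C^(k+1)_LeibDer *)
Definition leibder_cochainS (k : nat) : lmodType K :=
  match k with
  | 0 => cochain V 1
  | k'.+1 => (cochain V k'.+2 * cochain V k'.+1)%type
  end.

(* C^n_LeibDer, extended by 0 to negative degrees. *)
Definition leibder_cochain (n : int) : lmodType K :=
  match n with
  | Posz k.+1 => leibder_cochainS k
  | _ => 'rV[K]_0
  end.

(* The components of a cochain regarded as a pair (f, fbar), with fbar = 0 in
   degree 1. *)
Definition leibder_main (k : nat) : leibder_cochainS k -> cochain V k.+1 :=
  match k with
  | 0 => fun f => f
  | _.+1 => fun f => f.1
  end.

Definition leibder_bar (k : nat) : leibder_cochainS k -> cochain V k :=
  match k with
  | 0 => fun _ => 0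
  | _.+1 => fun f => f.2
  end.

Definition leibder_pack (k : nat) :
    cochain V k.+1 -> cochain V k -> leibder_cochainS k :=
  match k with
  | 0 => fun f _ => f
  | _.+1 => fun f fb => (f, fb)
  end.

Lemma arity_main m n p : (m + n)%N = p -> (m.+1 + n.+1)%N = p.+2.
Proof. by move=> <-; rewrite addSn addnS. Qed.

Lemma arity_barl m n p : (m + n)%N = p -> (m + n.+1)%N = p.+1.
Proof. by move=> <-; rewrite addnS. Qed.

Lemma arity_barr m n p : (m + n)%N = p -> (m.+1 + n)%N = p.+1.
Proof. by move=> <-. Qed.

(* The bracket on C^(m+1) x C^(n+1) -> C^(m+n+1); the sign (-1)^((m+1)+1) is
   that of a first argument of degree m + 1. *)
Definition leibder_bracketS m n p (e : (m + n)%N = p)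
    (F : leibder_cochainS m) (G : leibder_cochainS n) : leibder_cochainS p :=
  leibder_pack
    (cochain_bracket (arity_main e) (leibder_main F) (leibder_main G))
    ((-1) ^+ m.+2 *:
       cochain_bracket (arity_barr e) (leibder_main F) (leibder_bar G) +
     cochain_bracket (arity_barl e) (leibder_bar F) (leibder_main G)).

Lemma predz_arity (m n p : nat) :
  (m.+1 : int) + (n.+1 : int) = (p.+1 : int) + 1 -> (m + n)%N = p.
Proof. by rewrite -!PoszD => -[]; rewrite addnS addn1 => -[]. Qed.

(* All branches with value 0 have a zero space as one of the sources, except
   those with m, n >= 1 > p, which are excluded by m + n = p + 1. *)
Definition leibder_bracket (m n p : int) : m + n = p + 1 ->
    leibder_cochain m -> leibder_cochain n -> leibder_cochain p :=
  match m, n, p with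
  | Posz m'.+1, Posz n'.+1, Posz p'.+1 =>
      fun e => leibder_bracketS (predz_arity e)
  | _, _, _ => fun _ _ _ => 0
  end.

End LeibDerCochains.

Section GradedLie.
Variable K : fieldType.

(* As above, the degree of the value of a bracket is passed together with a
   proof of its equality with the expected sum. *)
Record is_graded_lie_bracket (L : int -> lmodType K)
    (br : forall p q r : int, p + q = r -> L p -> L q -> L r) : Prop := {
  graded_bilinearl : forall p q r (e : p + q = r) (y : L q),
    linear (fun x : L p => br p q r e x y) ;
  graded_bilinearr : forall p q r (e : p + q = r) (x : L p),
    linear (br p q r e x) ;
  graded_skew : forall p q r (e : p + q = r) (e' : q + p = r)
      (x : L p) (y : L q),
    br p q r e x y = - ((-1) ^ (p * q) *: br q p r e' y x) ;
  graded_jacobi : forall p q r pq qr pr s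
      (epq : p + q = pq) (eqr : q + r = qr) (epr : p + r = pr)
      (e1 : p + qr = s) (e2 : pq + r = s) (e3 : q + pr = s)
      (x : L p) (y : L q) (z : L r),
    br p qr s e1 x (br q r qr eqr y z) =
    br pq r s e2 (br p q pq epq x y) z +
    (-1) ^ (p * q) *: br q pr s e3 y (br p r pr epr x z) }.

Lemma shift_degree (p q r : int) : p + q = r -> (p + 1) + (q + 1) = (r + 1) + 1.
Proof. by move=> <-; rewrite addrACA addrA. Qed.

Definition is_degree_m1_graded_lie_bracket (C : int -> lmodType K)
    (br : forall m n p : int, m + n = p + 1 -> C m -> C n -> C p) : Prop :=
  @is_graded_lie_bracket (fun p => C (p + 1))
    (fun p q r e => br (p + 1) (q + 1) (r + 1) (shift_degree e)).

End GradedLie.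

(* Main.v *)
From HB Require Import structures.
Require Import Defs.
From mathcomp Require Import all_boot all_order all_fingroup all_algebra.
From mathcomp Require Import boolp zify.
Set Implicit Arguments.
Unset Strict Implicit.
Unset Printing Implicit Defensive.
Import GRing.Theory Num.Theory.
Local Open Scope ring_scope.

(** Why the theorem holds.

The pair bracket comes from the bracket on the single cochains L by extension
of scalars: write (f, fbar) as f + eps fbar, where eps has degree 1 and
eps^2 = 0. Moving eps to the front past f costs the sign (-1)^|f|, so the
bracket of the graded Lie algebra L (x) K[eps] is exactly the one of the
theorem. Concretely, the second component of the Jacobi identity for three
pairs is the sum of the Jacobi identities of (f, g, hbar), (f, gbar, h) and
(fbar, g, h); see [leibder_jacobiS].

It remains to see that L itself is a graded Lie algebra ([cochain_jacobi]).
Let the letters of V be odd, and let T(V) carry the signed unshuffle coproduct,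
which sends a word w to the signed sum of the pairs (u, v) of complementary
subwords. A cochain g with n + 1 arguments extends to an operator D_g on T(V)
determined by
   D_g (x w) = (-1)^n x D_g (w) + sum over (u, v) of +- g (x u) v,
where (u, v) runs through the unshuffles of w with u of length n. Unrolled over
the position of x, this recursion shows that the product of f and g which is
antisymmetrized in the bracket is f o D_g ([word_fun_bullet]). Since
the coproduct is coassociative and cocommutative up to sign, D_g is a
coderivation of it ([coderiv_unshuffle]); this gives, by induction on the word,
that the graded commutator of D_f and D_g is again of the form D, namely that of
the bracket of f and g ([coderiv_commutator]). The Jacobi identity follows by
expanding ([word_jacobi]).

To avoid tensors, everything is transposed: operators act on functions of
words, H being sent to H o D_g, and the linearity of a cochain is only invoked
when a sum appears in one letter of a word.

The sum over permutations that defines the product is turned into the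
recursive one by following the smallest shuffled position: it comes first
either in the first or in the second block ([sum_shuffles]). *)

(** * Unshuffles and coderivations on words *)

Section Words.
Variables (K : fieldType) (V : lmodType K).
Implicit Types (u v w : seq V).

Lemma eq_sign (R : pzRingType) a b : odd a = odd b -> (-1) ^+ a = (-1) ^+ b :> R.
Proof. by move=> ab; rewrite -(signr_odd _ a) ab signr_odd. Qed.

(** B summed over the signed unshuffles (u, v) of w: the first letter goes
either to the head of u, or to the head of v past all of u. *)
Fixpoint unshuffle (W : lmodType K) (B : seq V -> seq V -> W) w : W :=
  if w is x :: w' then
    unshuffle (fun u v => B (x :: u) v) w' +
    unshuffle (fun u v => (-1) ^+ size u *: B u (x :: v)) w'
  else B [::] [::].

(** H o D_g for a cochain g with n + 1 arguments; the factor (size u == n)%:R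
selects the subwords u that fill the arguments of g after x. It is a scalar,
and not a condition, so that it moves through linear operations. *)
Fixpoint coderiv (W : lmodType K) (g : seq V -> V) (n : nat) (H : seq V -> W) w :
    W :=
  if w is x :: w' then
    (-1) ^+ n *: coderiv g n (fun t => H (x :: t)) w' +
    unshuffle (fun u v => (size u == n)%:R *: H (g (x :: u) :: v)) w'
  else 0.

Section Target.
Variable W : lmodType K.
Implicit Types (B : seq V -> seq V -> W) (H : seq V -> W).

Lemma eq_unshuffle B B' w :
    (forall u v, (size u + size v = size w)%N -> B u v = B' u v) ->
  unshuffle B w = unshuffle B' w.
Proof.
elim: w B B' => [|x w IHw] B B' eqB /=; first exact: eqB.
by congr (_ + _); apply: IHw => u v suv; rewrite eqB //= ?addnS ?addSn suv.
Qed.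

Lemma unshuffleD B B' w :
  unshuffle (fun u v => B u v + B' u v) w = unshuffle B w + unshuffle B' w.
Proof.
elim: w B B' => //= x w IHw B B'.
by under [X in _ + X = _]eq_unshuffle do rewrite scalerDr; rewrite !IHw addrACA.
Qed.

Lemma unshuffleZ a B w :
  unshuffle (fun u v => a *: B u v) w = a *: unshuffle B w.
Proof.
elim: w B => //= x w IHw B; rewrite scalerDr -!IHw; congr (_ + _).
by apply: eq_unshuffle => u v _; rewrite !scalerA mulrC.
Qed.

Lemma unshuffle0 w : unshuffle (fun _ _ => 0 : W) w = 0.
Proof.
rewrite -[RHS](scale0r (unshuffle (fun _ _ => 0 : W) w)) -unshuffleZ.
by apply: eq_unshuffle => u v _; rewrite scaler0.
Qed.

(** Coassociativity of the unshuffle coproduct. *)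
Lemma unshuffleA (T : seq V -> seq V -> seq V -> W) w :
  unshuffle (fun u c => unshuffle (fun a b => T a b c) u) w =
  unshuffle (fun a v => unshuffle (fun b c => T a b c) v) w.
Proof.
elim: w T => //= x w IHw T; rewrite !unshuffleD -addrA !IHw; congr (_ + _).
under [X in _ + X]eq_unshuffle => u c _ do rewrite -unshuffleZ.
under [in X in _ + X]eq_unshuffle => u c _.
  under eq_unshuffle => a b sab do rewrite -sab exprD -scalerA.
  over.
rewrite (IHw (fun a b c => (-1) ^+ size a *: ((-1) ^+ size b *: T a b (x :: c)))).
rewrite -unshuffleD; apply: eq_unshuffle => a v _.
by rewrite !unshuffleZ -scalerDr.
Qed.

(** Graded cocommutativity of the unshuffle coproduct, for odd letters. *)
Lemma unshuffleC B w :
  unshuffle B w = unshuffle (fun u v => (-1) ^+ (size u * size v) *: B v u) w.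
Proof.
elim: w B => //= [|x w IHw] B; first by rewrite mul0n scale1r.
rewrite addrC; congr (_ + _).
  rewrite IHw; apply: eq_unshuffle => u v _.
  by rewrite scalerA -exprD mulSn addnC.
rewrite IHw; apply: eq_unshuffle => u v _.
rewrite scalerA -exprD mulnS; congr (_ *: _); apply: eq_sign.
by rewrite addnA addnn oddD odd_double.
Qed.

Lemma unshuffleCA (T : seq V -> seq V -> seq V -> W) w :
  unshuffle (fun a v => unshuffle (fun b c => T a b c) v) w =
  unshuffle (fun b v =>
    unshuffle (fun a c => (-1) ^+ (size a * size b) *: T a b c) v) w.
Proof.
rewrite -unshuffleA; under eq_unshuffle => u c _ do rewrite unshuffleC.
rewrite (unshuffleA (fun b a c => (-1) ^+ (size b * size a) *: T a b c)).
apply: eq_unshuffle => b v _; apply: eq_unshuffle => a c _.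
by rewrite mulnC.
Qed.

Variables (g : seq V -> V) (n : nat).

(** D_g shortens a word by exactly n letters, so only the values of H on words
of one length matter. *)
Lemma eq_coderiv H H' w :
    (forall t, (size t + n = size w)%N -> H t = H' t) ->
  coderiv g n H w = coderiv g n H' w.
Proof.
elim: w H H' => //= x w IHw H H' eqH; congr (_ *: _ + _).
  by apply: IHw => t st; rewrite eqH //= addSn st.
apply: eq_unshuffle => u v suv; case: eqP => [un|]; last by rewrite !scale0r.
by rewrite eqH //= addSn addnC -un suv.
Qed.

Lemma coderivD H H' w :
  coderiv g n (fun t => H t + H' t) w = coderiv g n H w + coderiv g n H' w.
Proof.
elim: w H H' => [|x w IHw] H H' /=; first by rewrite addr0.
rewrite IHw scalerDr addrACA -unshuffleD; congr (_ + _).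
by apply: eq_unshuffle => u v _; rewrite scalerDr.
Qed.

Lemma coderivZ a H w : coderiv g n (fun t => a *: H t) w = a *: coderiv g n H w.
Proof.
elim: w H => [|x w IHw] H /=; first by rewrite scaler0.
rewrite IHw scalerDr !scalerA mulrC -unshuffleZ; congr (_ + _).
by apply: eq_unshuffle => u v _; rewrite !scalerA mulrC.
Qed.

Lemma coderiv0 w : coderiv g n (fun _ => 0 : W) w = 0.
Proof.
rewrite -[RHS](scale0r (coderiv g n (fun _ => 0 : W) w)) -coderivZ.
by apply: eq_coderiv => t _; rewrite scaler0.
Qed.

Lemma coderiv_guard m H w :
  coderiv g n (fun t => (size t == m)%:R *: H t) w =
  (size w == (m + n)%N)%:R *: coderiv g n H w.
Proof.
rewrite -coderivZ; apply: eq_coderiv => t <-; by rewrite eqn_add2r.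
Qed.

(** D_g is a coderivation, of degree n up to parity. When the value of g
ends up in the second factor, the letters that g takes have crossed the first
factor: hence [unshuffleCA]. *)
Lemma coderiv_unshuffle B w :
  coderiv g n (unshuffle B) w =
  unshuffle (fun u v => coderiv g n (fun t => B t v) u +
                        (-1) ^+ (n * size u) *: coderiv g n (B u) v) w.
Proof.
elim: w B => [|x w IHw] B /=; first by rewrite scaler0 addr0.
(* Six sums arise on the left: the first four from the letter x being put in
   either factor and D_g then acting on either factor, the last two from x
   being the first argument of g, whose value goes to either factor. *)
rewrite coderivD !IHw scalerDr -!unshuffleZ.
under [X in _ + X = _]eq_unshuffle => u v _ do rewrite scalerDr.
rewrite [X in _ + X = _]unshuffleD.
under [X in _ + (X + _) = _]eq_unshuffle => u v _ do rewrite -unshuffleZ.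
rewrite -(unshuffleA (fun u a b => (size u == n)%:R *: B (g (x :: u) :: a) b)).
under [X in _ + (_ + X) = _]eq_unshuffle => u v _ do rewrite -unshuffleZ.
rewrite (unshuffleCA (fun u a b => (size u == n)%:R *:
  ((-1) ^+ size a *: B a (g (x :: u) :: b)))).
rewrite -!unshuffleD; apply: eq_unshuffle => u v _.
under [coderiv g n (fun t => (-1) ^+ size t *: _) u]eq_coderiv.
  move=> t st; rewrite -(@eq_sign _ (size u + n)); last first.
    by rewrite -st -addnA addnn oddD odd_double addbF.
  over.
under [X in _ + (_ + X) = _]eq_unshuffle => a c _.
  rewrite !scalerA.
  rewrite (_ : _ * _ = (-1) ^+ (size u + n * size u) * (size a == n)%:R).
    rewrite -scalerA; over.
  case: eqP => [->|_]; last by rewrite !(mul0r, mulr0).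
  by rewrite /= ?mul1r !mulr1 -exprD addnC.
rewrite unshuffleZ !coderivZ !scalerDr !scalerA -!exprD.
rewrite [LHS](AC ((2*2)*2) ((1*5*2)*(3*(4*6)))).
congr (_ + _ + _ *: _ + (_ *: _ + (_ *: _ + _ *: _))); apply: eq_sign.
all: rewrite ?mulnS ?oddD ?oddM; by case: (odd n); case: (odd (size u)).
Qed.

End Target.

Section LinearTarget.
Variables (U W : lmodType K) (phi : {linear U -> W}).

Lemma linear_unshuffle (B : seq V -> seq V -> U) w :
  phi (unshuffle B w) = unshuffle (fun u v => phi (B u v)) w.
Proof.
elim: w B => //= x w IHw B; rewrite linearD !IHw; congr (_ + _).
by apply: eq_unshuffle => u v _; rewrite linearZ.
Qed.

Lemma linear_coderiv g n (H : seq V -> U) w :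
  phi (coderiv g n H w) = coderiv g n (fun t => phi (H t)) w.
Proof.
elim: w H => [|x w IHw] H /=; first by rewrite linear0.
rewrite linearD linearZ IHw linear_unshuffle; congr (_ + _).
by apply: eq_unshuffle => u v _; rewrite linearZ.
Qed.

End LinearTarget.

Definition multilinear (W : lmodType K) (H : seq V -> W) : Prop :=
  forall u v, linear (fun x => H (u ++ x :: v)).

Section Multilinear.
Variables (W : lmodType K).
Implicit Types (H : seq V -> W).

Lemma multilinear_head H v : multilinear H ->
  exists phi : {linear V -> W}, forall x, H (x :: v) = phi x.
Proof.
move=> mH; pose F := GRing.isLinear.Build K V W _ _ (mH [::] v).
by pose phi : {linear V -> W} := HB.pack (fun x => H (x :: v)) F; exists phi.
Qed.

Lemma multilinear_cons H x : multilinear H -> multilinear (fun t => H (x :: t)).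
Proof. by move=> mH u v; apply: (mH (x :: u)). Qed.

Lemma coderiv_linear_map n a g g' H w : multilinear H ->
  coderiv (fun t => a *: g t + g' t) n H w =
  a *: coderiv g n H w + coderiv g' n H w.
Proof.
elim: w H => [|x w IHw] H mH /=; first by rewrite scaler0 addr0.
rewrite (IHw _ (multilinear_cons x mH)) !scalerDr !scalerA mulrC addrACA.
rewrite -!unshuffleZ -unshuffleD; congr (_ + _).
apply: eq_unshuffle => u v _; rewrite (mH [::] v) /=.
by rewrite scalerDr !scalerA mulrC.
Qed.

Definition word_bracket m n (f g : seq V -> V) : seq V -> V :=
  fun w => coderiv g n f w - (-1) ^+ (m * n) *: coderiv f m g w.

(** Besides the recursive term, applying D_g and then D_f to x w produces the
words whose first letter contains x together with the values of both cochains,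
which assemble to (f o D_g) (x u) v, and two cross terms, where f and g act at
separate places and only one of them absorbs x. *)
Lemma coderiv_coderiv_cons f m g n H x w : multilinear H ->
  coderiv g n (coderiv f m H) (x :: w) =
  (-1) ^+ (m + n) *: coderiv g n (coderiv f m (fun t => H (x :: t))) w +
  unshuffle (fun u v => (size u == (m + n)%N)%:R *:
     H (coderiv g n f (x :: u) :: v)) w +
  ((-1) ^+ (m * n + n) *: unshuffle (fun u v => (size u == m)%:R *:
     coderiv g n (fun t => H (f (x :: u) :: t)) v) w +
   (-1) ^+ m *: unshuffle (fun u v => (size u == n)%:R *:
     coderiv f m (fun t => H (g (x :: u) :: t)) v) w).
Proof.
move=> mH; pose nested u v := unshuffle (fun a b => (size a == n)%:R *:
  H (f (g (x :: a) :: b) :: v)) u.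
have headE u v : H (coderiv g n f (x :: u) :: v) =
    (-1) ^+ n *: coderiv g n (fun t => H (f (x :: t) :: v)) u + nested u v.
  have [phi phiE] := multilinear_head v mH; rewrite phiE /= linearD linearZ /=.
  rewrite linear_coderiv linear_unshuffle; congr (_ *: _ + _).
    by apply: eq_coderiv => t _; rewrite phiE.
  by apply: eq_unshuffle => a b _; rewrite linearZ phiE.
have nestedE : unshuffle (fun u v => (size u == (m + n)%N)%:R *: nested u v) w =
    unshuffle (fun u v => (size u == n)%:R *:
      unshuffle (fun a b => (size a == m)%:R *: H (f (g (x :: u) :: a) :: b)) v) w.
  under [RHS]eq_unshuffle do rewrite -unshuffleZ.
  rewrite -(unshuffleA (fun a b v => (size a == n)%:R *: ((size b == m)%:R *:
    H (f (g (x :: a) :: b) :: v)))).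
  apply: eq_unshuffle => u v _; rewrite -unshuffleZ; apply: eq_unshuffle.
  move=> a b sab; rewrite !scalerA -!natrM !mulnb; congr (_%:R *: _).
  by case: (size a =P n) => [<-|_]; rewrite ?andbF // -sab addnC eqn_add2r andbT.
rewrite /= coderivD coderivZ coderiv_unshuffle unshuffleD.
under [X in _ *: (_ + (X + _)) + _]eq_unshuffle do rewrite coderiv_guard.
under [X in _ *: (_ + (_ + X)) + _]eq_unshuffle => u v _.
  rewrite coderivZ scalerA.
  rewrite (_ : _ * _ = (-1) ^+ (m * n) * (size u == m)%:R).
    rewrite -scalerA; over.
  by case: eqP => [->|_]; [rewrite mulnC|rewrite !mulr0].
rewrite unshuffleZ.
under [X in _ + X = _]eq_unshuffle => u v _ do
  rewrite scalerDr scalerA mulrC -scalerA.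
under [X in _ = _ + X + _]eq_unshuffle => u v _ do
  rewrite headE scalerDr scalerA mulrC -scalerA.
rewrite [X in _ + X = _]unshuffleD [X in _ = _ + X + _]unshuffleD.
rewrite !unshuffleZ nestedE !scalerDr !scalerA -!exprD.
rewrite [(n + m)%N]addnC [(n + m * n)%N]addnC.
by rewrite [LHS](AC (1*2*2) ((1*(2*5))*(3*4))).
Qed.

(** The graded commutator of two such operators is again one: exchanging f and
g permutes the cross terms of [coderiv_coderiv_cons], which therefore cancel. *)
Lemma coderiv_commutator f m g n H w : multilinear H ->
  coderiv g n (coderiv f m H) w - (-1) ^+ (m * n) *: coderiv f m (coderiv g n H) w =
  coderiv (word_bracket m n f g) (m + n) H w.
Proof.
elim: w H => [|x w IHw] H mH; first by rewrite /= scaler0 subr0.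
have headE u v : H (word_bracket m n f g (x :: u) :: v) =
    H (coderiv g n f (x :: u) :: v) -
    (-1) ^+ (m * n) *: H (coderiv f m g (x :: u) :: v).
  by have [phi phiE] := multilinear_head v mH; rewrite !phiE linearB linearZ.
rewrite !coderiv_coderiv_cons // [coderiv _ (m + n) _ _]/=.
rewrite -(IHw _ (multilinear_cons x mH)).
under [X in _ = _ + X]eq_unshuffle => u v _ do
  rewrite headE scalerDr -scaleNr scalerA mulrC -scalerA.
rewrite unshuffleD unshuffleZ [(n + m)%N]addnC.
set R1 := coderiv g n _ _; set R2 := coderiv f m _ _.
set E1 := unshuffle _ w; set E2 := unshuffle _ w.
set X1 := unshuffle _ w; set X2 := unshuffle _ w.
have cross : (-1) ^+ (m * n + n) *: E2 + (-1) ^+ m *: X1 =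
    (-1) ^+ (m * n) *: ((-1) ^+ (n * m + m) *: X1 + (-1) ^+ n *: E2).
  rewrite scalerDr !scalerA -!exprD addrC; congr (_ *: _ + _).
  by apply: eq_sign; rewrite !oddD [(n * m)%N]mulnC addbA addbb.
rewrite scalerDr opprD -cross addrACA subrr addr0 scalerDr opprD addrACA.
by rewrite scalerBr !scalerA scaleNr [(-1) ^+ (m * n) * _]mulrC.
Qed.

End Multilinear.

Lemma coderiv_word_bracket e l m n f g w :
  coderiv e l (word_bracket m n f g) w =
  coderiv e l (coderiv g n f) w - (-1) ^+ (m * n) *: coderiv e l (coderiv f m g) w.
Proof.
rewrite -scaleNr -coderivZ -coderivD; apply: eq_coderiv => t _.
by rewrite /word_bracket scaleNr.
Qed.

Lemma word_bracketC m n f g w :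
  word_bracket m n f g w = - ((-1) ^+ (m * n) *: word_bracket n m g f w).
Proof.
rewrite /word_bracket [(n * m)%N]mulnC scalerBr scalerA -expr2 sqrr_sign.
by rewrite scale1r opprB.
Qed.

(** By [coderiv_commutator], D of a bracket is a commutator, so all terms become
iterated products such as f o D_g o D_h; each of the six orders of f, g and h
then has total coefficient zero. *)
Lemma word_jacobi m n k f g h w :
    multilinear f -> multilinear g -> multilinear h ->
  word_bracket m (n + k) f (word_bracket n k g h) w =
  word_bracket (m + n) k (word_bracket m n f g) h w +
  (-1) ^+ (m * n) *: word_bracket n (m + k) g (word_bracket m k f h) w.
Proof.
move=> mf mg mh; rewrite {1 3 5}/word_bracket -!coderiv_commutator //.
rewrite !coderiv_word_bracket mulnDl !mulnDr [(n * m)%N]mulnC !exprD.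
set a := (-1) ^+ (m * n); set b := (-1) ^+ (n * k); set c := (-1) ^+ (m * k).
rewrite !scalerBr !scalerA !opprB mulrA -[a * a]expr2 sqrr_sign mul1r.
rewrite [RHS](AC ((2*2)*(2*2)) (((1*8)*(3*6))*((5*2)*(7*4)))).
rewrite /= subrr [b * c]mulrC subrr !addr0.
by rewrite [a * c * b]mulrAC [c * b * a]mulrC -mulrA [b * c]mulrC !mulrA.
Qed.
End Words.

(** * Shuffle permutations *)

Section Shuffles.
Variable p : nat.
Implicit Types (s : 'S_p.+1).

Lemma is_shuffleP i n s : reflect
  [/\ forall j, (j <= p)%N -> (j <= i)%N -> s (inord j) = inord j,
      forall j k, (k <= p)%N -> (i < j)%N -> (j < k)%N -> (k <= i + n)%N ->
        (s (inord j) < s (inord k))%N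
    & forall j k, (k <= p)%N -> (i + n < j)%N -> (j < k)%N ->
        (s (inord j) < s (inord k))%N]
  (is_shuffle i n s).
Proof.
apply: (iffP and3P) => -[H1 H2 H3]; split.
- move=> j jp ji; move/forallP/(_ (inord j)): H1.
  by rewrite inordK // ji => /eqP.
- move=> j k kp ij jk kn; have jp := ltnW (leq_trans jk kp).
  move/forallP/(_ (inord j))/forallP/(_ (inord k)): H2.
  by rewrite !inordK // ?ltnS // ij jk kn.
- move=> j k kp ij jk; have jp := ltnW (leq_trans jk kp).
  move/forallP/(_ (inord j))/forallP/(_ (inord k)): H3.
  by rewrite !inordK // ?ltnS // ij jk.
- apply/forallP => j; apply/implyP => ji; apply/eqP.
  by have := H1 j (leq_ord j) ji; rewrite inord_val.
- apply/forallP => j; apply/forallP => k; apply/implyP => /and3P[ij jk kn].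
  by have := H2 j k (leq_ord k) ij jk kn; rewrite !inord_val.
- apply/forallP => j; apply/forallP => k; apply/implyP => /andP[ij jk].
  by have := H3 j k (leq_ord k) ij jk; rewrite !inord_val.
Qed.

Lemma inord_inj j k : (j <= p)%N -> (k <= p)%N ->
  inord j = inord k :> 'I_p.+1 -> j = k.
Proof. by move=> jp kp /(congr1 val); rewrite /= !inordK. Qed.

Lemma perm_gt_fixed i s k :
    (forall j, (j <= p)%N -> (j <= i)%N -> s (inord j) = inord j) ->
  (k <= p)%N -> (i < k)%N -> (i < s (inord k))%N.
Proof.
move=> fixs kp ik; rewrite ltnNge; apply/negP => ski.
have := fixs _ (leq_ord (s (inord k))) ski.
by rewrite inord_val => /perm_inj /(congr1 val); rewrite /= inordK //; lia.
Qed.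

(** A shuffle increases on both blocks, so the least moved position i + 1 can
only be taken at the beginning of a block. *)
Lemma shuffle_head_cases i n s : (i < p)%N -> is_shuffle i n s ->
  (0 < n)%N && (s (inord i.+1) == inord i.+1) \/
  (i + n < p)%N /\ s (inord (i + n).+1) = inord i.+1.
Proof.
move=> ip /is_shuffleP[H1 H2 H3]; set i1 := inord i.+1.
have [k kp sk] : exists2 k, (k <= p)%N & s (inord k) = i1.
  by exists (s^-1%g i1); rewrite ?leq_ord // inord_val permKV.
have ski : s (inord k) = i.+1 :> nat by rewrite sk inordK.
have ik : (i < k)%N.
  rewrite ltnNge; apply/negP => ki; move: ski; rewrite H1 // inordK //; lia.
have min_k j : (j <= p)%N -> (i < j)%N -> (j < k)%N ->
    ~ (s (inord j) < s (inord k))%N.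
  by move=> jp ij jk; rewrite ski; have := perm_gt_fixed H1 jp ij; lia.
have [kn|nk] := leqP k (i + n).
  left; have [/eqP ki|ki] := boolP (k == i.+1).
    by rewrite {1}/i1 -ki sk eqxx andbT; lia.
  by case: (min_k i.+1) => //; [lia|apply: H2 => //; lia].
right; split; first by lia.
have [/eqP <- //|ki] := boolP (k == (i + n).+1).
by case: (min_k (i + n).+1); [lia|lia|lia|apply: H3 => //; lia].
Qed.

Lemma is_shuffle_left i n s : (i < p)%N ->
  is_shuffle i n.+1 s && (s (inord i.+1) == inord i.+1) = is_shuffle i.+1 n s.
Proof.
move=> ip; apply/andP/is_shuffleP => [[/is_shuffleP[H1 H2 H3] /eqP si]|].
  split=> [j jp ji|j k *|j k *]; [|apply: H2 => //; lia|apply: H3 => //; lia].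
  by have [/eqP -> //|ji1] := boolP (j == i.+1); apply: H1; lia.
move=> [H1 H2 H3]; split; last by rewrite H1.
apply/is_shuffleP; split=> [j *|j k kp ij jk ki|j k *].
- by apply: H1; lia.
- have [/eqP ->|ji1] := boolP (j == i.+1); last by apply: H2; lia.
  by rewrite {1}H1 // inordK //; apply: perm_gt_fixed H1 _ _; lia.
- by apply: H3; lia.
Qed.

Section Cycle.
Variables (i n : nat) (inp : (i + n < p)%N).

(** The cycle that moves position i + 1 behind the n positions that follow it.
Precomposing with it turns a shuffle whose second block starts with i + 1 into
one that fixes i + 1. *)
Definition shuffle_cycle : 'S_p.+1 :=
  lift_perm (inord i.+1) (inord (i + n).+1) 1%g.

Lemma shuffle_cycle_head : shuffle_cycle (inord i.+1) = inord (i + n).+1.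
Proof. exact: lift_perm_id. Qed.

Lemma shuffle_cycle_lift k : (k < p)%N ->
  shuffle_cycle (inord (bump i.+1 k)) = inord (bump (i + n).+1 k).
Proof.
move=> kp; pose k' := Ordinal kp.
have -> : inord (bump i.+1 k) = lift (inord i.+1) k' :> 'I_p.+1.
  by apply: val_inj; rewrite /= !inordK ?/bump //; lia.
rewrite lift_perm_lift perm1.
by apply: val_inj; rewrite /= !inordK ?/bump //; lia.
Qed.

Lemma shuffle_cycle_mid j : (i < j)%N -> (j <= i + n)%N ->
  shuffle_cycle (inord j.+1) = inord j.
Proof.
move=> ij jn; have jp : (j < p)%N by lia.
have := shuffle_cycle_lift jp.
by rewrite /bump ij (_ : ((i + n).+1 <= j)%N = false) //; lia.
Qed.

Lemma shuffle_cycle_out j : (j <= i)%N || ((i + n).+1 < j <= p)%N ->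
  shuffle_cycle (inord j) = inord j.
Proof.
case/orP => [ji|/andP[ij jp]].
  have jp : (j < p)%N by lia.
  have := shuffle_cycle_lift jp; rewrite /bump (_ : (i < j)%N = false).
    by rewrite (_ : ((i + n).+1 <= j)%N = false) //; lia.
  by lia.
case: j ij jp => // j ij jp; have := shuffle_cycle_lift jp; rewrite /bump.
have [ij' inj] : (i < j)%N /\ (i + n < j)%N by lia.
by rewrite ij' inj.
Qed.

Lemma odd_shuffle_cycle : odd_perm shuffle_cycle = odd n.
Proof.
rewrite /shuffle_cycle odd_lift_perm odd_perm1 addbF !inordK //=; last by lia.
by rewrite oddD; case: (odd i); case: (odd n).
Qed.

Lemma is_shuffle_right s (s' := (shuffle_cycle^-1 * s)%g) :
  is_shuffle i n s' &&
    ~~ ((0 < n)%N && (s' (inord i.+1) == inord i.+1)) = is_shuffle i.+1 n s.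
Proof.
have sE j : s' (shuffle_cycle j) = s j by rewrite permM permK.
have s'hd : s' (inord (i + n).+1) = s (inord i.+1).
  by rewrite -shuffle_cycle_head sE.
have s'mid j : (i < j)%N -> (j <= i + n)%N -> s' (inord j) = s (inord j.+1).
  by move=> ij jn; rewrite -(shuffle_cycle_mid ij jn) sE.
have s'out j : (j <= i)%N || ((i + n).+1 < j <= p)%N ->
    s' (inord j) = s (inord j).
  by move=> jP; rewrite -{1}(shuffle_cycle_out jP) sE.
apply/andP/is_shuffleP => [[sh noC]|[H1 H2 H3]].
  have [hC|[_ hd]] := shuffle_head_cases (leq_ltn_trans (leq_addr _ _) inp) sh.
    by rewrite hC in noC.
  case/is_shuffleP: sh => H1 H2 H3; split=> [j jp ji|j k kp ij jk kn|j k *].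
  - have [/eqP ->|ji1] := boolP (j == i.+1); first by rewrite -s'hd.
    by rewrite -s'out ?H1 //; lia.
  - case: j k kp ij jk kn => // j [//|k] kp ij jk kn.
    by rewrite -!s'mid; try apply: H2; lia.
  - by rewrite -!s'out; try apply: H3; lia.
split; last first.
  apply/negP => /andP[n0 /eqP]; rewrite s'mid //; last by lia.
  rewrite -[in RHS](H1 i.+1) //; last by lia.
  by move/perm_inj/inord_inj; lia.
apply/is_shuffleP; split=> [j jp ji|j k kp ij jk kn|j k kp ij jk].
- by rewrite s'out ?ji // H1 //; lia.
- by rewrite !s'mid; try apply: H2; lia.
- rewrite (s'out k); last by lia.
  have [/eqP ->|ji1] := boolP (j == (i + n).+1).
    rewrite s'hd {1}H1 ?inordK //; try lia.
    by apply: perm_gt_fixed H1 _ _; lia.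
  by rewrite s'out; try apply: H3; lia.
Qed.

End Cycle.

Variables (K : fieldType) (V W : lmodType K) (x : 'I_p.+1 -> V).

Definition segment (y : 'I_p.+1 -> V) i l := [seq y (inord j) | j <- iota i l].

(** Induction on p - i. The shuffles with i + 1 first in the first block are
the shuffles of i + 2 .. p with a first block shorter by one; those with i + 1
first in the second block become, after a cycle of sign (-1)^n, the shuffles of
i + 2 .. p with the same n. These are the two terms of [unshuffle]. *)
Lemma sum_shuffles (B : seq V -> seq V -> W) i n : (i + n <= p)%N ->
  \sum_(s : 'S_p.+1 | is_shuffle i n s) (-1) ^+ s *:
     B (segment (x \o s) i.+1 n) (segment (x \o s) (i + n).+1 (p - (i + n))) =
  unshuffle (fun u v => (size u == n)%:R *: B u v) (segment x i.+1 (p - i)).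
Proof.
move d_def: (p - i)%N => d; elim: d i n d_def B => [|d IHd] i n d_def B inp.
  have [-> ->] : i = p /\ n = 0%N by lia.
  rewrite addn0 subnn /= scale1r (big_pred1 1%g) ?odd_perm1 ?scale1r // => s.
  apply/is_shuffleP/eqP => [[H1 _ _]|->].
    apply/permP => j; rewrite perm1 -(inord_val j) H1 //; exact: leq_ord.
  by split=> *; rewrite !perm1 // !inordK //; lia.
have ip : (i < p)%N by lia.
have -> : segment x i.+1 d.+1 = x (inord i.+1) :: segment x i.+2 d by [].
rewrite [RHS]/= (bigID (fun s : 'S_p.+1 => (0 < n)%N && (s (inord i.+1) == inord i.+1))).
congr (_ + _).
  case: n inp => [|n] inp.
    rewrite big1 => [|s]; last by rewrite ltnn andbF.
    by under eq_unshuffle do rewrite scale0r; rewrite unshuffle0.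
  under eq_bigl => s do rewrite is_shuffle_left //.
  under [RHS]eq_unshuffle do rewrite /= eqSS.
  rewrite -(IHd i.+1 n); [|lia|lia].
  apply: eq_bigr => s; rewrite addSnnS => /is_shuffleP[H1 _ _].
  by rewrite /segment /= H1.
(* If i + n = p, then the second block is empty and both sides vanish. *)
have [inp'|ninp] := ltnP (i + n) p; last first.
  rewrite big1 => [|s /andP[sh]]; last first.
    by case: (shuffle_head_cases ip sh) => [->|[]] //; lia.
  rewrite (@eq_unshuffle _ _ _ _ (fun _ _ => 0)) ?unshuffle0 //.
  move=> u v; rewrite size_map size_iota => suv.
  by rewrite (_ : (size u == n) = false) ?scale0r ?scaler0 //; lia.
rewrite (reindex_inj (mulgI (shuffle_cycle i n)^-1)%g) /=.
under eq_bigl => s do rewrite is_shuffle_right //.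
rewrite (@eq_unshuffle _ _ _ _ (fun u v => (-1) ^+ n *:
   ((size u == n)%:R *: B u (x (inord i.+1) :: v)))); last first.
  move=> u v _; case: eqP => [->|]; rewrite ?scale0r ?scaler0 //.
rewrite unshuffleZ.
rewrite -(IHd i.+1 n (_ : _ = d) (fun u v => B u (x (inord i.+1) :: v))); [|lia|lia].
rewrite scaler_sumr; apply: eq_bigr => s /is_shuffleP[H1 _ _].
set s' := (_ * s)%g.
have sE j : s' (shuffle_cycle i n j) = s j by rewrite permM permK.
rewrite scalerA odd_permM odd_permV odd_shuffle_cycle // signr_addb signr_odd.
congr (_ *: B _ _).
  rewrite /segment -[i.+2]add1n iotaDl -map_comp; apply/eq_in_map => j.
  rewrite mem_iota /= => ji; rewrite -sE add1n shuffle_cycle_mid //; lia.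
rewrite (_ : p - (i + n) = (p - (i.+1 + n)).+1)%N; last by lia.
rewrite /segment /=; congr (_ :: _).
  by rewrite -(shuffle_cycle_head i n) sE H1.
apply/eq_in_map => j; rewrite mem_iota /= => ji.
by rewrite -{1}(@shuffle_cycle_out i n inp' j) ?sE //; lia.
Qed.

End Shuffles.

(** * From cochains to functions of words *)

Section CochainWords.
Variables (K : fieldType) (V : lmodType K).

(** The extension by zero to words of other lengths makes [word_fun f]
linear in every letter of every word. *)
Definition word_fun n (f : cochain V n) : seq V -> V :=
  fun w => (size w == n)%:R *: f (fun i => nth 0 w i).

Lemma word_fun_linear n a (f f' : cochain V n) w :
  word_fun (a *: f + f') w = a *: word_fun f w + word_fun f' w.
Proof.
rewrite /word_fun -[(a *: f + f') _]/(a *: f _ + f' _).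
by rewrite scalerDr !scalerA mulrC.
Qed.

Lemma word_funZ n a (f : cochain V n) w :
  word_fun (a *: f) w = a *: word_fun f w.
Proof. by rewrite /word_fun -[(a *: f) _]/(a *: f _) !scalerA mulrC. Qed.

Lemma word_fun_inj n : injective (@word_fun n).
Proof.
move=> f f' ff'; apply: val_inj => /=; apply/funext => x.
have := congr1 (fun F => F [seq x i | i <- enum 'I_n]) ff'.
rewrite /word_fun size_map size_enum_ord eqxx !scale1r.
suff -> : (fun i : 'I_n => nth 0 [seq x i | i <- enum 'I_n] i) = x by [].
by apply/funext => i; rewrite (nth_map i) ?size_enum_ord // nth_ord_enum.
Qed.

Lemma multilinear_word_fun n (f : cochain V n) : multilinear (word_fun f).
Proof.
move=> u v a x y; rewrite /word_fun !size_cat /=.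
case: eqP => [un|_]; last by rewrite !scale0r scaler0 addr0.
rewrite !scale1r; have un' : (size u < n)%N by lia.
have /asboolP fP := cochain_funP f.
have E z : (fun i : 'I_n => nth 0 (u ++ z :: v) i) =
    [eta (fun i : 'I_n => nth 0 (u ++ 0 :: v) i) with Ordinal un' |-> z].
  apply/funext => i /=; rewrite !nth_cat -val_eqE /=.
  by case: ltngtP => // iu; [rewrite -(subnSK iu)|rewrite iu subnn].
by rewrite (E (a *: x + y)) (E x) (E y) fP.
Qed.

(** Unfolds the recursion into the sum over the position i that becomes the
first argument of g, as in the definition of the product of cochains. *)
Lemma coderiv_sum (W : lmodType K) g n (H : seq V -> W) w :
  coderiv g n H w = \sum_(i < size w) (-1) ^+ (i * n) *:
    unshuffle (fun u v => (size u == n)%:R *: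
      H (take i w ++ g (nth 0 w i :: u) :: v)) (drop i.+1 w).
Proof.
elim: w H => [|x w IHw] H /=; first by rewrite big_ord0.
rewrite big_ord_recl mul0n scale1r take0 drop0 addrC IHw scaler_sumr.
by congr (_ + _); apply: eq_bigr => i _; rewrite scalerA -exprD -mulSn.
Qed.

Lemma insertion_word m n p (f : cochain V m.+1) (g : cochain V n.+1)
    (i : 'I_m.+1) (y : 'I_p.+1 -> V) : (m + n)%N = p ->
  f (insertion g i y) =
  word_fun f (segment y 0 i ++
    word_fun g (y (inord i) :: segment y i.+1 n) ::
    segment y (i + n).+1 (p - (i + n))).
Proof.
move=> e; have im : (i <= m)%N by rewrite -ltnS.
rewrite /word_fun size_cat /= !size_map !size_iota eqxx scale1r.
rewrite (_ : _ == _); last by lia.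
rewrite scale1r; congr (f _); apply/funext => j; rewrite /insertion.
have jm : (j <= m)%N by rewrite -ltnS.
rewrite nth_cat size_map size_iota -val_eqE; case: ltngtP => [ji|ij|ji].
- by rewrite (nth_map 0%N) ?size_iota // nth_iota.
- rewrite -(subnSK ij) /= (nth_map 0%N) ?size_iota; last by lia.
  by rewrite nth_iota; [congr (y (inord _))|]; lia.
rewrite ji subnn /=; congr (g _); apply/funext => k.
have kn : (k <= n)%N by rewrite -ltnS.
case: k kn => -[|k] /= kn' kn; first by rewrite addn0.
by rewrite (nth_map 0%N) ?size_iota // nth_iota // addSnnS.
Qed.

Lemma word_fun_bullet m n p (e : (m + n)%N = p) (f : cochain V m.+1)
    (g : cochain V n.+1) :
  word_fun (bullet e f g) = coderiv (word_fun g) n (word_fun f).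
Proof.
apply/funext => w; rewrite {1}/word_fun; case: eqP => [wp|wp]; last first.
  rewrite scale0r (@eq_coderiv _ _ _ _ _ _ (fun _ => 0)) ?coderiv0 // => t.
  by rewrite /word_fun; case: eqP => [->|_] tw; [lia|rewrite scale0r].
rewrite scale1r /= /bullet_fun; set x := fun i : 'I_p.+1 => _.
have wE : w = segment x 0 p.+1.
  apply: (@eq_from_nth _ 0) => [|i]; rewrite ?size_map ?size_iota wp // => ip.
  by rewrite (nth_map 0%N) ?size_iota // nth_iota // add0n /x inordK.
have takeE i : (i <= p.+1)%N -> take i w = segment x 0 i.
  by move=> ip; rewrite wE -map_take take_iota (minn_idPl ip).
have dropE i : drop i w = segment x i (p.+1 - i).
  by rewrite wE -map_drop drop_iota.
pose summand i := (-1) ^+ (i * n) *: unshuffle (fun u v => (size u == n)%:R *: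
  word_fun f (take i w ++ word_fun g (nth 0 w i :: u) :: v)) (drop i.+1 w).
rewrite coderiv_sum wp -(big_mkord predT summand) /summand.
rewrite (big_cat_nat (n := m.+1)) //=; last by lia.
(* Beyond position m fewer than n letters are left, too few for g. *)
rewrite [X in _ + X]big_nat_cond [X in _ + X]big1 ?addr0; last first.
  move=> i /andP[/andP[mi ip] _].
  rewrite (@eq_unshuffle _ _ _ _ (fun _ _ => 0)) ?unshuffle0 ?scaler0 //.
  move=> u v; rewrite size_drop wp => uv.
  by rewrite (_ : (size u == n) = false) ?scale0r //; lia.
rewrite big_mkord; apply: eq_bigr => i _; congr (_ *: _).
have im : (i <= m)%N by rewrite -ltnS.
rewrite dropE subSS.
rewrite -(sum_shuffles x (fun u v =>
  word_fun f (take i w ++ word_fun g (nth 0 w i :: u) :: v))); last by lia.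
apply: eq_bigr => s /is_shuffleP[H1 _ _]; congr (_ *: _).
rewrite (insertion_word _ _ _ _ e); congr (word_fun f (_ ++ word_fun g (_ :: _) :: _)).
  rewrite takeE; last by lia.
  by apply/eq_in_map => j; rewrite mem_iota /= => ji; rewrite H1 //; lia.
by rewrite /= H1 ?/x ?inordK //; lia.
Qed.

End CochainWords.

(** * The bracket of cochains *)

Section CochainBracket.
Variables (K : fieldType) (V : lmodType K).

Lemma word_fun_bracket m n p e (f : cochain V m.+1) (g : cochain V n.+1) :
  word_fun (@cochain_bracket K V m.+1 n.+1 p.+1 e f g) =
  word_bracket m n (word_fun f) (word_fun g).
Proof.
apply/funext => w; rewrite /= addrC -scaleNr word_fun_linear !word_fun_bullet.
by rewrite addrC scaleNr.
Qed.

Lemma cochain_bracket_arity0l n p e (f : cochain V 0) (g : cochain V n) :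
  @cochain_bracket K V 0 n p e f g = 0.
Proof. by []. Qed.

Lemma cochain_bracket_arity0r m p e (f : cochain V m) (g : cochain V 0) :
  @cochain_bracket K V m 0 p e f g = 0.
Proof. by case: m e f. Qed.

(** The sign is written with m + 1 and n + 1, which have the parities of m - 1
and n - 1, to avoid truncated subtraction. *)
Lemma cochain_bracketC m n p (e : (m + n)%N = p.+1) (e' : (n + m)%N = p.+1)
    (f : cochain V m) (g : cochain V n) :
  cochain_bracket e f g =
  - ((-1) ^+ (m.+1 * n.+1) *: cochain_bracket e' g f).
Proof.
case: m n p e e' f g => [|m] [|n] [|p] e e' f g; try by rewrite /= ?scaler0 oppr0.
apply: word_fun_inj; apply/funext => w.
rewrite -scaleNr word_funZ !word_fun_bracket word_bracketC scaleNr.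
congr (- (_ *: _)); apply: eq_sign; rewrite !oddM /= !negbK //.
Qed.

Lemma cochain_bracket_linearl m n p e (g : cochain V n) :
  linear (fun f : cochain V m => @cochain_bracket K V m n p e f g).
Proof.
move=> a f f'; case: m n p e f f' g => [|m] [|n] [|p] e f f' g;
  try by rewrite /= scaler0 addr0.
apply: word_fun_inj; apply/funext => w.
rewrite word_fun_linear !word_fun_bracket /word_bracket.
rewrite (_ : word_fun (a *: f + f') = fun t => a *: word_fun f t + word_fun f' t).
  rewrite coderivD coderivZ coderiv_linear_map; last exact: multilinear_word_fun.
  by rewrite scalerBr scalerDr opprD addrACA !scalerA mulrC.
by apply/funext => t; rewrite word_fun_linear.
Qed.

Lemma cochain_bracket_linearr m n p e (f : cochain V m) :
  linear (@cochain_bracket K V m n p e f).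
Proof.
move=> a g g'; have e' : (n + m)%N = p.+1 by rewrite addnC.
rewrite !(cochain_bracketC _ e') cochain_bracket_linearl.
by rewrite scalerDr opprD scalerN !scalerA mulrC.
Qed.

HB.instance Definition _ m n p e :=
  bilinear_isBilinear.Build K (cochain V m) (cochain V n) (cochain V p) _ _
    (@cochain_bracket K V m n p e)
    (@cochain_bracket_linearl m n p e, @cochain_bracket_linearr m n p e).

(** With arguments of arity 0 allowed: all three terms are then 0. The second
components of pairs of degree 1 need this case. *)
Lemma cochain_jacobi m n k mn nk mk p (emn : (m + n)%N = mn.+1)
    (enk : (n + k)%N = nk.+1) (emk : (m + k)%N = mk.+1)
    (e1 : (m + nk)%N = p.+1) (e2 : (mn + k)%N = p.+1) (e3 : (n + mk)%N = p.+1)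
    (f : cochain V m) (g : cochain V n) (h : cochain V k) :
  cochain_bracket e1 f (cochain_bracket enk g h) =
  cochain_bracket e2 (cochain_bracket emn f g) h +
  (-1) ^+ (m.+1 * n.+1) *: cochain_bracket e3 g (cochain_bracket emk f h).
Proof.
have [m0|m_gt0] := posnP m.
  move: (m) (m0) f emn emk e1 => ? -> f ? ? ?.
  by rewrite !cochain_bracket_arity0l linear0l linear0r
             scaler0 addr0.
have [n0|n_gt0] := posnP n.
  move: (n) (n0) g emn enk e3 => ? -> g ? ? ?.
  by rewrite cochain_bracket_arity0r !cochain_bracket_arity0l linear0l
             linear0r scaler0 addr0.
have [k0|k_gt0] := posnP k.
  move: (k) (k0) h enk emk e2 => ? -> h ? ? ?.
  by rewrite !cochain_bracket_arity0r !linear0r scaler0 addr0.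
case: m n k m_gt0 n_gt0 k_gt0 f g h emn enk emk e1 e2 e3
  => [|m] [|n] [|k] // _ _ _ f g h emn enk emk.
have [mnE nkE mkE] : [/\ mn = (m + n).+1, nk = (n + k).+1 & mk = (m + k).+1].
  by split; lia.
move: mn nk mk mnE nkE mkE emn enk emk => _ _ _ -> -> -> emn enk emk.
case: p => [|p] e1 e2 e3; first by rewrite /= scaler0 addr0.
apply: word_fun_inj; apply/funext => w.
rewrite addrC word_fun_linear !word_fun_bracket word_jacobi;
  try exact: multilinear_word_fun.
rewrite addrC; congr (_ *: _ + _); apply: eq_sign; rewrite !oddM /= !negbK //.
Qed.

End CochainBracket.

(** * The bracket of pairs *)

Section LeibDer.
Variables (K : fieldType) (V : lmodType K).

Lemma leibder_cochainS_ext k (F G : leibder_cochainS V k) :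
  leibder_main F = leibder_main G -> leibder_bar F = leibder_bar G -> F = G.
Proof. by case: k F G => [|k] //= [f fb] [g gb] /= -> ->. Qed.

Fact leibder_main_linear k : linear (@leibder_main K V k).
Proof. by case: k. Qed.

Fact leibder_bar_linear k : linear (@leibder_bar K V k).
Proof. by case: k => // a F G; rewrite /= scaler0 addr0. Qed.

HB.instance Definition _ k := GRing.isLinear.Build K (leibder_cochainS V k)
  (cochain V k.+1) _ (@leibder_main K V k) (@leibder_main_linear k).
HB.instance Definition _ k := GRing.isLinear.Build K (leibder_cochainS V k)
  (cochain V k) _ (@leibder_bar K V k) (@leibder_bar_linear k).

Lemma leibder_main_bracket m n p (e : (m + n)%N = p)
    (F : leibder_cochainS V m) (G : leibder_cochainS V n) :
  leibder_main (leibder_bracketS e F G) =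
  cochain_bracket (arity_main e) (leibder_main F) (leibder_main G).
Proof. by rewrite /leibder_bracketS; move: (cochain_bracket _ _ _); case: p e. Qed.

(** When p = 0 the left-hand side is 0, and so are both brackets on the right
because each has an argument of arity 0. *)
Lemma leibder_bar_bracket m n p (e : (m + n)%N = p)
    (F : leibder_cochainS V m) (G : leibder_cochainS V n) :
  leibder_bar (leibder_bracketS e F G) =
  (-1) ^+ m *: cochain_bracket (arity_barr e) (leibder_main F) (leibder_bar G) +
  cochain_bracket (arity_barl e) (leibder_bar F) (leibder_main G).
Proof.
have -> : (-1) ^+ m = (-1) ^+ m.+2 :> K by rewrite !exprS mulrA mulrNN mulr1 mul1r.
case: p e => [|p] // e; have [m0 n0] : m = 0%N /\ n = 0%N by lia.
move: m0 n0 F G e => -> -> F G e.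
by rewrite cochain_bracket_arity0l cochain_bracket_arity0r scaler0 addr0.
Qed.

Fact leibder_bracketS_linearl m n p (e : (m + n)%N = p) G :
  linear (fun F : leibder_cochainS V m => leibder_bracketS e F G).
Proof.
move=> a F F'; apply: leibder_cochainS_ext.
  by rewrite leibder_main_linear !leibder_main_bracket leibder_main_linear
             cochain_bracket_linearl.
rewrite leibder_bar_linear !leibder_bar_bracket leibder_main_linear.
rewrite leibder_bar_linear !cochain_bracket_linearl !scalerDr addrACA.
by rewrite !scalerA mulrC.
Qed.

Lemma leibder_bracketSC m n p (e : (m + n)%N = p) (e' : (n + m)%N = p)
    (F : leibder_cochainS V m) (G : leibder_cochainS V n) :
  leibder_bracketS e F G = - ((-1) ^+ (m * n) *: leibder_bracketS e' G F).
Proof.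
rewrite -scaleNr; apply: leibder_cochainS_ext.
  rewrite linearZ /= !leibder_main_bracket (cochain_bracketC _ (arity_main e')).
  by rewrite scaleNr; congr (- (_ *: _)); apply: eq_sign; rewrite !oddM /= !negbK.
rewrite linearZ /= !leibder_bar_bracket (cochain_bracketC _ (arity_barl e')).
rewrite [X in _ + X](cochain_bracketC _ (arity_barr e')) addrC.
rewrite scaleNr !scalerDr opprD scalerN !scalerA -!exprD.
congr (- (_ *: _) - _ *: _); apply: eq_sign; rewrite !(oddD, oddM) /= !negbK.
all: by case: (odd m); case: (odd n).
Qed.

Fact leibder_bracketS_linearr m n p (e : (m + n)%N = p) F :
  linear (@leibder_bracketS K V m n p e F).
Proof.
move=> a G G'; have e' : (n + m)%N = p by rewrite addnC.
rewrite !(leibder_bracketSC _ e') leibder_bracketS_linearl.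
by rewrite scalerDr opprD scalerN !scalerA mulrC.
Qed.

(** The second component is the Jacobi identity of (f, g, hbar) with the factor
(-1)^(m + n), that of (f, gbar, h) with the factor (-1)^m, and that of
(fbar, g, h). *)
Lemma leibder_jacobiS m n k mn nk mk p (emn : (m + n)%N = mn)
    (enk : (n + k)%N = nk) (emk : (m + k)%N = mk)
    (e1 : (m + nk)%N = p) (e2 : (mn + k)%N = p) (e3 : (n + mk)%N = p)
    (F : leibder_cochainS V m) (G : leibder_cochainS V n)
    (H : leibder_cochainS V k) :
  leibder_bracketS e1 F (leibder_bracketS enk G H) =
  leibder_bracketS e2 (leibder_bracketS emn F G) H +
  (-1) ^+ (m * n) *: leibder_bracketS e3 G (leibder_bracketS emk F H).
Proof.
apply: leibder_cochainS_ext; rewrite linearD linearZ /=.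
  rewrite !leibder_main_bracket (cochain_jacobi (arity_main emn) _ (arity_main emk) _
             (arity_main e2) (arity_main e3)).
  by congr (_ + _ *: _); apply: eq_sign; rewrite !oddM /= !negbK.
rewrite !leibder_bar_bracket !leibder_main_bracket.
set f := leibder_main F; set g := leibder_main G; set h := leibder_main H.
set fb := leibder_bar F; set gb := leibder_bar G; set hb := leibder_bar H.
have J1 := cochain_jacobi (arity_main emn) (arity_barr enk) (arity_barr emk)
  (arity_barr e1) (arity_barr e2) (arity_barr e3) f g hb.
have J2 := cochain_jacobi (arity_barr emn) (arity_barl enk) (arity_main emk)
  (arity_barr e1) (arity_barl e2) (arity_barl e3) f gb h.
have J3 := cochain_jacobi (arity_barl emn) (arity_main enk) (arity_barl emk)
  (arity_barl e1) (arity_barl e2) (arity_barr e3) fb g h.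
rewrite !cochain_bracket_linearr !cochain_bracket_linearl J1 J2 J3.
rewrite (_ : (-1) ^+ mn = (-1) ^+ (m + n)); last by rewrite emn.
rewrite !scalerDr !scalerA -!exprD.
rewrite [LHS](AC (2*2*2) ((1*(3*5))*((2*6)*4))).
have eq_odd a b : odd a = odd b -> (-1) ^+ a = (-1) ^+ b :> K by exact: eq_sign.
rewrite (eq_odd (m + n + m.+2 * n.+2)%N (m * n + n + m)%N); last first.
  by rewrite !(oddD, oddM) /= !negbK; case: (odd m); case: (odd n).
rewrite (eq_odd (m.+1 * n.+2)%N (m * n + n)%N); last first.
  by rewrite !(oddD, oddM) /= !negbK; case: (odd m); case: (odd n).
rewrite (eq_odd (m + m.+2 * n.+1)%N (m * n)%N) //.
by rewrite !(oddD, oddM) /= !negbK; case: (odd m); case: (odd n).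
Qed.

End LeibDer.

(** * Integer degrees *)

Section IntegerDegrees.

Lemma shifted_degreeM (m n : nat) : (m.+1%:Z - 1) * (n.+1%:Z - 1) = (m * n)%N.
Proof. by rewrite !intS ![1 + _]addrC !addrK -PoszM. Qed.

Variables (K : fieldType) (V : lmodType K).

Lemma leibder_bracket_linearl (m n p : int) (e : m + n = p + 1) y :
  linear (fun x => @leibder_bracket K V m n p e x y).
Proof.
move=> a x x'; move: m n p e x x' y => [[|m]|m] [[|n]|n] [[|p]|p] e x x' y;
  try by rewrite /= scaler0 addr0.
exact: leibder_bracketS_linearl.
Qed.

Lemma leibder_bracket_linearr (m n p : int) (e : m + n = p + 1) x :
  linear (@leibder_bracket K V m n p e x).
Proof.
move=> a y y'; move: m n p e x y y' => [[|m]|m] [[|n]|n] [[|p]|p] e x y y';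
  try by rewrite /= scaler0 addr0.
exact: leibder_bracketS_linearr.
Qed.

Lemma leibder_bracketC (m n p : int) (e : m + n = p + 1) (e' : n + m = p + 1)
    (x : leibder_cochain V m) (y : leibder_cochain V n) :
  leibder_bracket e x y =
  - ((-1) ^ ((m - 1) * (n - 1)) *: leibder_bracket e' y x).
Proof.
move: m n p e e' x y => [[|m]|m] [[|n]|n] [[|p]|p] e e' x y;
  try by rewrite /= scaler0 oppr0.
rewrite shifted_degreeM; exact: leibder_bracketSC.
Qed.

Lemma leibder_bracket_nonpos_l (m n p : int) (e : m + n = p + 1)
    (x : leibder_cochain V m) (y : leibder_cochain V n) :
  (m <= 0)%R -> leibder_bracket e x y = 0.
Proof. by case: m e x => [[|m]|m]. Qed.

Lemma leibder_bracket_nonpos_r (m n p : int) (e : m + n = p + 1)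
    (x : leibder_cochain V m) (y : leibder_cochain V n) :
  (n <= 0)%R -> leibder_bracket e x y = 0.
Proof. by move: m n e x y => [[|m]|m] [[|n]|n]. Qed.

HB.instance Definition _ m n p e :=
  bilinear_isBilinear.Build K (leibder_cochain V m) (leibder_cochain V n)
    (leibder_cochain V p) _ _ (@leibder_bracket K V m n p e)
    (@leibder_bracket_linearl m n p e, @leibder_bracket_linearr m n p e).

Lemma leibder_jacobi (m n k mn nk mk p : int) (emn : m + n = mn + 1)
    (enk : n + k = nk + 1) (emk : m + k = mk + 1)
    (e1 : m + nk = p + 1) (e2 : mn + k = p + 1) (e3 : n + mk = p + 1)
    (x : leibder_cochain V m) (y : leibder_cochain V n)
    (z : leibder_cochain V k) :
  leibder_bracket e1 x (leibder_bracket enk y z) =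
  leibder_bracket e2 (leibder_bracket emn x y) z +
  (-1) ^ ((m - 1) * (n - 1)) *:
    leibder_bracket e3 y (leibder_bracket emk x z).
Proof.
have [m0|m_gt0] := lerP m 0.
  rewrite !(leibder_bracket_nonpos_l _ x) // linear0l linear0r.
  by rewrite scaler0 addr0.
have [n0|n_gt0] := lerP n 0.
  rewrite !(leibder_bracket_nonpos_l _ y) // (leibder_bracket_nonpos_r _ _ y) //.
  by rewrite linear0l linear0r scaler0 addr0.
have [k0|k_gt0] := lerP k 0.
  rewrite !(leibder_bracket_nonpos_r _ _ z) // !linear0r.
  by rewrite scaler0 addr0.
case: m n k m_gt0 n_gt0 k_gt0 emn enk emk x y z e1 e2 e3
  => [[|m]|m] // [[|n]|n] // [[|k]|k] // _ _ _ emn enk emk x y z.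
have [mnE nkE mkE] :
    [/\ mn = (m + n).+1, nk = (n + k).+1 & mk = (m + k).+1 :> int].
  by split; lia.
move: mn nk mk mnE nkE mkE emn enk emk => _ _ _ -> -> -> emn enk emk e1.
have pE : p = (m + (n + k)).+1 by lia.
move: p pE e1 => _ -> e1 e2 e3.
rewrite shifted_degreeM; exact: leibder_jacobiS.
Qed.

End IntegerDegrees.

Theorem proposition3p10 (K : fieldType) (K0 : [pchar K] =i pred0)
  (g : leibder_pair K) :
  is_degree_m1_graded_lie_bracket (@leibder_bracket K g).
Proof.
split=> [p q r e y|p q r e x|p q r e e' x y|].
- exact: leibder_bracket_linearl.
- exact: leibder_bracket_linearr.
- by rewrite (leibder_bracketC _ (shift_degree e')) !addrK.
move=> p q r pq qr pr s epq eqr epr e1 e2 e3 x y z.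
rewrite (leibder_jacobi (shift_degree epq) _ (shift_degree epr) _
  (shift_degree e2) (shift_degree e3)).
by rewrite !addrK.
Qed.
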